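(* Let $A$ be a Boolean algebra. The following are equivalent. (1) $A$ is projective. (2) There is a base $X\subseteq A^{+}$ of $A$, closed under non-zero meets, which carries a coherent finite-separation map, i.e. there exists a coherent finite-separation map $s\colon X\to [X]^{<\omega}$.
   Context: Boolean algebras are written $(A,\vee,\wedge,-,0,1)$ and satisfy $0\neq 1$. Write $A^{+}=A\setminus\{0\}$, and $[X]^{<\omega}$ for the set of finite subsets of $X$. A Boolean algebra $A$ is projective if for every surjective homomorphism $g\colon C\to B$ of Boolean algebras and every homomorphism $h\colon A\to B$ there is a homomorphism $k\colon A\to C$ with $g\circ k=h$. A set $X\subseteq A^{+}$ is a base of $A$ if every non-zero element of $A$ is a finite join of pairwise disjoint members of $X$. $X$ is closed under non-zero meets if $a,b\in X$ and $a\wedge b\neq 0$ imply $a\wedge b\in X$. For a finite $F\subseteq A$ put $F^{\wedge}=\{\bigwedge G:\emptyset\neq G\subseteq F\}\setminus\{0\}$. Let $X\subseteq A^{+}$ be closed under non-zero meets. A map $s\colon X\to[X]^{<\omega}$ is a finite-separation map if for all $a,b\in X$ with $a\wedge b=0$ there are $c,d\in s(a)\cap s(b)$ with $c\wedge d=0$, $a\leqslant c$ and $b\leqslant d$. It is coherent if, in addition, $s(a\wedge b)\subseteq (s(a)\cup s(b))^{\wedge}$ for all $a,b\in X$ with $a\wedge b>0$. *)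

(* Defs.v *)
From mathcomp Require Import all_boot all_order finmap.
From mathcomp Require Import boolp classical_sets.

Set Implicit Arguments.
Unset Strict Implicit.
Unset Printing Implicit Defensive.

Import Order.Theory.
Local Open Scope order_scope.

(* Boolean algebras are taken to be the complemented distributive lattices
   [ctbDistrLatticeType]. The boolean equality and the choice operator they
   carry are no restriction under the classical axioms of [boolp]. The library
   allows [\bot = \top], so [0 <> 1] is a separate hypothesis. *)
Definition nontrivial_ba {d} (A : ctbDistrLatticeType d) : Prop :=
  (\bot : A) <> \top.

(* The library's [{tblmorphism A -> B}] is stated without complements. *)
Definition ba_hom {dA dB} {A : ctbDistrLatticeType dA}
    {B : ctbDistrLatticeType dB} (f : A -> B) : Prop :=
  [/\ {morph f : x y / x `|` y}, {morph f : x y / x `&` y},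
      {morph f : x / ~` x}, f \bot = \bot & f \top = \top].

Definition projective_ba {dA} (A : ctbDistrLatticeType dA) : Prop :=
  forall (dB dC : Order.disp_t)
    (B : ctbDistrLatticeType dB) (C : ctbDistrLatticeType dC),
    nontrivial_ba B -> nontrivial_ba C ->
    forall (g : C -> B) (h : A -> B),
      ba_hom g -> (forall b : B, exists c : C, g c = b) -> ba_hom h ->
      exists2 k : A -> C, ba_hom k & forall a : A, g (k a) = h a.

Section Separation.
Context {d : Order.disp_t} {A : ctbDistrLatticeType d}.

Definition nonzero_set (X : set A) : Prop := forall x, X x -> x <> \bot.

Definition base (X : set A) : Prop :=
  nonzero_set X /\
  forall a : A, a <> \bot ->
    exists F : {fset A},
      [/\ forall x, x \in F -> X x,
          forall x y, x \in F -> y \in F -> x <> y -> x `&` y = \bot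
        & a = \join_(x <- F) x].

Definition closed_nonzero_meet (X : set A) : Prop :=
  forall a b, X a -> X b -> a `&` b <> \bot -> X (a `&` b).

Definition meet_closure (F : {fset A}) : set A :=
  [set x | x <> \bot /\
    exists G : {fset A},
      [/\ G <> fset0, fsubset G F & x = \meet_(y <- G) y]]%classic.

(* A map from [X] to the finite subsets of [X] is represented by a total map
   on [A], whose values outside [X] are irrelevant. *)
Definition finite_separation (X : set A) (s : A -> {fset A}) : Prop :=
  (forall a, X a -> forall x, x \in s a -> X x) /\
  forall a b, X a -> X b -> a `&` b = \bot ->
    exists c e : A,
      [/\ c \in fsetI (s a) (s b), e \in fsetI (s a) (s b),
          c `&` e = \bot, a <= c & b <= e].

Definition coherent_finite_separation (X : set A) (s : A -> {fset A}) : Prop :=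
  finite_separation X s /\
  forall a b, X a -> X b -> \bot < a `&` b ->
    forall x, x \in s (a `&` b) -> meet_closure (fsetU (s a) (s b)) x.

End Separation.

(* Main.v *)
Require Import Defs.
From HB Require Import structures.
From mathcomp Require Import all_boot all_order finmap.
From mathcomp Require Import boolp classical_sets.

(** Both conditions are equivalent to the existence of a family of relatively
    complete subalgebras of A, containing {0,1}, closed under unions of chains,
    and such that each proper member D extends to a member generated over D by
    countably many elements, not all of them in D.

    Such a family reduces the construction of a structure on A to one step, from
    a relatively complete D to D(z). A lifting k extends to D(z): take any c0
    above the prescribed image of z and replace it by (c0 \/ k(l)) /\ k(u), where
    l <= z <= u are the best approximations of z in D. A base X of D with its map
    s extends too: split the part r of D on which z is undetermined into disjoint
    members r_i of X, add the elements p /\ z and p - z for p <= r_i in X, and put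
    s(p /\ z) = s(p - z) = s(p) U {r_i /\ z, r_i - z}.

    Conversely, if A is projective, let k be a section of the evaluation of
    the free algebra over the set A; the family consists of the subalgebras D such
    that k(x) only involves generators from D for all x in D. Given a coherent
    s : X -> [X]^{<omega}, it consists of the subalgebras whose elements are finite
    joins of members of s-closed subsets of X: finite separation makes them
    relatively complete, and coherence makes the s-closed sets stable under
    closure by nonzero meets, hence under generation by countable pieces. *)

Set Implicit Arguments.
Unset Strict Implicit.
Unset Printing Implicit Defensive.

Import Order.Theory.
Local Open Scope order_scope.

(** * Relatively complete subalgebras and filtrations *)

Section Splitting.
Context {d : Order.disp_t} {A : ctbDistrLatticeType d}.
Implicit Types (a b x y z : A).

(** The element that agrees with [a] on [z] and with [b] off [z]. All Boolean operations act on it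
    componentwise, so such elements already form the subalgebra generated by [D] and [z]. *)
Definition mix z a b := (a `&` z) `|` (b `&` ~` z).

Lemma mixIl z a b : mix z a b `&` z = a `&` z.
Proof. by rewrite /mix meetUl -!meetA meetxx meetCx meetx0 joinx0. Qed.

Lemma mixIr z a b : mix z a b `&` ~` z = b `&` ~` z.
Proof. by rewrite /mix meetUl -!meetA meetxx meetxC meetx0 join0x. Qed.

Lemma mix_id z a : mix z a a = a.
Proof. by rewrite /mix -meetUr joinxC meetx1. Qed.

Lemma le_split z x y : x `&` z <= y -> x `&` ~` z <= y -> x <= y.
Proof. by move=> h1 h2; rewrite -(mix_id z x) /mix leUx h1. Qed.

Lemma eq_split z x y : x `&` z = y `&` z -> x `&` ~` z = y `&` ~` z -> x = y.
Proof. by move=> h1 h2; rewrite -(mix_id z x) -(mix_id z y) /mix h1 h2. Qed.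

Lemma mixI z a b a' b' :
  mix z a b `&` mix z a' b' = mix z (a `&` a') (b `&` b').
Proof.
by apply: (@eq_split z); rewrite -meetA ?mixIl ?mixIr meetA meetAC
  ?mixIl ?mixIr meetAC.
Qed.

Lemma disjP x y : x `&` y = \bot <-> x <= ~` y.
Proof. by rewrite -disj_leC; split=> /eqP. Qed.

Lemma lex_disj x y : x <= y -> x <= ~` y -> x = \bot.
Proof.
by move=> h1 h2; apply/eqP; rewrite -lex0 -(meetxC y) lexI h1.
Qed.

(** Complementation passes to the relative algebra of elements below [w]. *)
Lemma compl_meetr x y w : x `&` w = y `&` w -> ~` x `&` w = ~` y `&` w.
Proof.
suff H u v : u `&` w = v `&` w -> ~` u `&` w <= ~` v `&` w.
  by move=> e; apply/le_anti; rewrite !H.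
move=> e; rewrite lexI leIr andbT; apply/disjP.
by rewrite -meetA [w `&` v]meetC -e meetA meetCx meet0x.
Qed.

Lemma mixC z a b : ~` mix z a b = mix z (~` a) (~` b).
Proof.
apply: (@eq_split z); rewrite ?mixIl ?mixIr; apply: compl_meetr.
  by rewrite mixIl.
by rewrite mixIr.
Qed.

Lemma joinE a b : a `|` b = ~` (~` a `&` ~` b).
Proof. by rewrite complI !complK. Qed.

Lemma joins_meetl (T : Type) (r : seq T) (f : T -> A) y :
  (\join_(x <- r) f x) `&` y = \join_(x <- r) (f x `&` y).
Proof. by elim/big_rec2: _ => [|x u v _ <-]; rewrite ?meet0x ?meetUl. Qed.

Definition subalg (D : set A) : Prop :=
  [/\ D \bot, forall a b, D a -> D b -> D (a `&` b) & forall a, D a -> D (~` a)].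

Lemma subalgU D a b : subalg D -> D a -> D b -> D (a `|` b).
Proof. by case=> _ sI sC Da Db; rewrite joinE; apply/sC/sI; apply: sC. Qed.

Lemma subalgT D : subalg D -> D \top.
Proof. by case=> s0 _ sC; rewrite -compl0; apply: sC. Qed.

Lemma subalg_joins D (r : seq A) :
  subalg D -> (forall x, x \in r -> D x) -> D (\join_(x <- r) x).
Proof.
move=> sD rD; rewrite big_seq; apply: big_ind => //; first by case: sD.
by move=> ? ?; apply: subalgU.
Qed.

Definition relatively_complete (D : set A) : Prop :=
  forall a, exists u, [/\ D u, a <= u & forall b, D b -> a <= b -> u <= b].

Definition adjoin (D : set A) z : set A :=
  [set x | exists a b, [/\ D a, D b & x = mix z a b]]%classic.

Lemma sub_adjoin D z : (D `<=` adjoin D z)%classic.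
Proof. by move=> a Da; exists a, a; rewrite mix_id. Qed.

Lemma adjoin_self D z : subalg D -> adjoin D z z.
Proof.
move=> sD; exists \top, \bot; split; [exact: subalgT|by case: sD|].
by rewrite /mix meet1x meet0x joinx0.
Qed.

Lemma subalg_adjoin D z : subalg D -> subalg (adjoin D z).
Proof.
move=> sD; have [s0 sI sC] := sD; split.
- exact: sub_adjoin.
- move=> _ _ [a [b [Da Db ->]]] [a' [b' [Da' Db' ->]]].
  by exists (a `&` a'), (b `&` b'); rewrite mixI; split=> //; apply: sI.
- move=> _ [a [b [Da Db ->]]].
  by exists (~` a), (~` b); rewrite mixC; split=> //; apply: sC.
Qed.

Lemma adjoin_min D E z :
  subalg E -> (D `<=` E)%classic -> E z -> (adjoin D z `<=` E)%classic.
Proof.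
move=> sE DE Ez _ [a [b [/DE Ea /DE Eb ->]]]; have [_ sI sC] := sE.
by apply: subalgU => //; apply: sI => //; apply: sC.
Qed.

Lemma rc_adjoin D z : relatively_complete D -> relatively_complete (adjoin D z).
Proof.
move=> rcD a.
have [u [Du au uP]] := rcD (a `&` z); have [v [Dv av vP]] := rcD (a `&` ~` z).
exists (mix z u v); split; first by exists u, v.
- by rewrite -[leLHS](mix_id z) /mix leU2 // lexI ?au ?av leIr.
- move=> _ [p [q [Dp Dq ->]]] apq.
  have up : u <= p.
    by apply: uP => //; apply: le_trans (leIl p z); rewrite -(mixIl z p q) leI2.
  have vq : v <= q.
    by apply: vP => //; apply: le_trans (leIl q (~` z)); rewrite -(mixIr z p q) leI2.
  by rewrite /mix leU2 // leI2.
Qed.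

Inductive gen (S : set A) : set A :=
| gen_base a : S a -> gen S a
| gen_bot : gen S \bot
| gen_meet a b : gen S a -> gen S b -> gen S (a `&` b)
| gen_compl a : gen S a -> gen S (~` a).

Lemma subalg_gen S : subalg (gen S).
Proof. by split; [exact: gen_bot|exact: gen_meet|exact: gen_compl]. Qed.

Lemma gen_min S D : subalg D -> (S `<=` D)%classic -> (gen S `<=` D)%classic.
Proof. by case=> s0 sI sC SD a; elim=> //; auto. Qed.

End Splitting.

(** * Zorn's lemma along a filtration *)

Section Tower.
Context {d : Order.disp_t} {A : ctbDistrLatticeType d}.
Local Open Scope classical_set_scope.

(* A weak form of Haydon's description of projective algebras as unions of
   chains of relatively complete subalgebras with countable steps. *)
Record filtration (SS : set (set A)) : Prop := Filtration {
  filtration_bot : SS [set x | x = \bot \/ x = \top];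
  filtration_subalg : forall D, SS D -> subalg D;
  filtration_rc : forall D, SS D -> relatively_complete D;
  filtration_chain : forall FF : set (set A), FF `<=` SS -> FF !=set0 ->
    total_on FF subset -> SS (\bigcup_(D in FF) D);
  filtration_next : forall D, SS D -> D <> setT ->
    exists z : nat -> A, SS (gen (D `|` range z)) /\ exists n, ~ D (z n) }.

Variable T : Type.
(** A subalgebra together with the graph of the structure built on it. Structures are kept as graphs
    so that the limit of a chain is a plain union. *)
Local Notation stage := (set A * set T)%type.

Definition stage_le (p q : stage) : Prop := p.1 `<=` q.1 /\ p.2 `<=` q.2.

Lemma stage_le_trans p q r : stage_le p q -> stage_le q r -> stage_le p r.
Proof. by move=> [h1 h2] [h3 h4]; split=> x ?; auto. Qed.

Lemma stage_chain_pair (CC : set stage) x y : total_on CC stage_le ->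
  (\bigcup_(p in CC) p.2) x -> (\bigcup_(p in CC) p.2) y ->
  exists p, [/\ CC p, p.2 x & p.2 y].
Proof.
move=> tot [p Cp px] [q Cq qy]; have [[_ pq]|[_ qp]] := tot p q Cp Cq.
  by exists q; split=> //; apply: pq.
by exists p; split=> //; apply: qp.
Qed.

Definition chain_closed (Q : set A -> set T -> Prop) : Prop :=
  forall CC : set stage, CC !=set0 -> total_on CC stage_le ->
    (forall p, CC p -> Q p.1 p.2) ->
    Q (\bigcup_(p in CC) p.1) (\bigcup_(p in CC) p.2).

Definition extends_to_adjoin (Q : set A -> set T -> Prop) : Prop :=
  forall D t z, subalg D -> relatively_complete D -> Q D t ->
    exists t', t `<=` t' /\ Q (adjoin D z) t'.

(** The elements [z n] are adjoined one by one, each finite stage staying relatively complete. The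
    union of the stages may lose this property; in [filtration_induction] it is recovered from
    membership in [SS]. *)
Lemma countable_extension (Q : set A -> set T -> Prop) D t (z : nat -> A) :
  chain_closed Q -> extends_to_adjoin Q ->
  subalg D -> relatively_complete D -> Q D t ->
  exists t', t `<=` t' /\ Q (gen (D `|` range z)) t'.
Proof.
move=> Qchain Qstep sD rcD QDt.
(* The invariant is packed into a sigma type so that [choice] yields a step function that can be
   iterated. *)
pose P (p : stage) := [/\ subalg p.1, relatively_complete p.1 & Q p.1 p.2].
have next (px : {p | P p} * nat) : exists q : {p | P p},
    (sval q).1 = adjoin (sval px.1).1 (z px.2) /\ (sval px.1).2 `<=` (sval q).2.
  case: px => -[[E u] /= [sE rcE QE]] n.
  have [t' [tt' Qt']] := Qstep _ _ (z n) sE rcE QE.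
  have Pq : P (adjoin E (z n), t').
    by split=> //; [exact: subalg_adjoin|exact: rc_adjoin].
  by exists (exist _ _ Pq).
have [f fP] := choice next.
have P0 : P (D, t) by [].
pose sq := fix sq n : {p | P p} :=
  if n is m.+1 then f (sq m, m) else exist _ _ P0.
pose st n := sval (sq n).
have stS n : (st n.+1).1 = adjoin (st n).1 (z n) /\ (st n).2 `<=` (st n.+1).2.
  exact: (fP (sq n, n)).
have st_le m n : (m <= n)%N -> stage_le (st m) (st n).
  elim: n => [|n IH]; first by rewrite leqn0 => /eqP->; split.
  rewrite leq_eqVlt => /orP[/eqP->|/IH]; first by split.
  move/stage_le_trans; apply.
  by have [e ?] := stS n; split=> //; rewrite e; apply: sub_adjoin.
have stP n : P (st n) by apply: (proj2_sig (sq n)).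
have -> : gen (D `|` range z) = \bigcup_(p in range st) p.1.
  apply/seteqP; split.
  - apply: gen_min => [|x [Dx|[n _ <-]]].
    + split.
      * by exists (st 0%N); [exists 0%N|have [[]] := stP 0%N].
      * move=> a b [_ [m _ <-] am] [_ [n _ <-] bn].
        have [[_ sI _] _ _] := stP (maxn m n).
        exists (st (maxn m n)); first by exists (maxn m n).
        by apply: sI; [apply: (st_le _ _ (leq_maxl m n)).1|
                       apply: (st_le _ _ (leq_maxr m n)).1].
      * move=> a [_ [m _ <-] am]; exists (st m); first by exists m.
        by have [[_ _ sC] _ _] := stP m; apply: sC.
    + by exists (st 0%N); first by exists 0%N.
    + exists (st n.+1); first by exists n.+1.
      by have [-> _] := stS n; apply: adjoin_self; have [] := stP n.
  - move=> x [_ [n _ <-]]; elim: n x => [|n IH] x.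
      by move=> Dx; apply: gen_base; left.
    have [-> _] := stS n; apply: adjoin_min => //; first exact: subalg_gen.
    by apply: gen_base; right; exists n.
exists (\bigcup_(p in range st) p.2); split.
  by move=> x tx; exists (st 0%N) => //; exists 0%N.
apply: Qchain => [|_ _ [m _ <-] [n _ <-]|_ [n _ <-]].
- by exists (st 0%N); exists 0%N.
- by have [mn|/ltnW nm] := leqP m n; [left|right]; apply: st_le.
- by have [] := stP n.
Qed.

(** Zorn's lemma applies to the stages with subalgebra in [SS]. At a maximal stage the subalgebra is
    everything, since otherwise [filtration_next] and [countable_extension] enlarge it. *)
Lemma filtration_induction (SS : set (set A)) (Q : set A -> set T -> Prop) :
  filtration SS -> (exists t, Q [set x | x = \bot \/ x = \top] t) ->
  extends_to_adjoin Q -> chain_closed Q -> exists t, Q setT t.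
Proof.
move=> fS [t0 Q0] Qstep Qchain.
pose P (p : stage) := SS p.1 /\ Q p.1 p.2.
have P0 : P ([set x | x = \bot \/ x = \top], t0).
  by split=> //; apply: filtration_bot.
pose R (p q : {p | P p}) := `[< stage_le (sval p) (sval q) >].
have [||CC totCC|[[D t] /= [SD QD]] maxD] := @ZL_preorder _ (exist _ _ P0) R.
- by move=> p; apply/asboolP; split.
- by move=> p q r /asboolP qp /asboolP pr; apply/asboolP/(stage_le_trans qp).
(* Closure under unions is only available for nonempty chains; the empty chain is bounded by the
   initial stage. *)
- have [[p0 Cp0]|C0] := pselect (CC !=set0); last first.
    by exists (exist _ _ P0) => p Cp; case: C0; exists p.
  pose CC' := sval @` CC.
  have tot : total_on CC' stage_le.
    by move=> _ _ [p Cp <-] [q Cq <-]; have [/asboolP|/asboolP] := totCC p q Cp Cq;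
      [left|right].
  have PCC' p : CC' p -> P p by move=> [q Cq <-]; apply: (proj2_sig q).
  have ne : CC' !=set0 by exists (sval p0), p0.
  have PU : P (\bigcup_(p in CC') p.1, \bigcup_(p in CC') p.2).
    split; last by apply: Qchain => // p /PCC' [].
    have -> : \bigcup_(p in CC') p.1 = \bigcup_(E in [set p.1 | p in CC']) E.
      by rewrite bigcup_image.
    apply: (filtration_chain fS).
    + by move=> _ [p /PCC'[Sp _] <-].
    + by exists (sval p0).1, (sval p0) => //; exists p0.
    + by move=> _ _ [p Cp <-] [q Cq <-]; have [[? _]|[? _]] := tot p q Cp Cq;
        [left|right].
  exists (exist _ _ PU) => p Cp; apply/asboolP; split=> x px /=;
    by exists (sval p) => //; exists p.
- have [<-|DT] := pselect (D = setT); first by exists t.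
  have [z [Sz [n nD]]] := filtration_next fS SD DT.
  have [t' [tt' Qt']] := countable_extension z Qchain Qstep
    (filtration_subalg fS SD) (filtration_rc fS SD) QD.
  have PD' : P (gen (D `|` range z), t') by [].
  (* Maximality puts the larger algebra back inside [D], although some [z n] lies outside [D]. *)
  have /asboolP[/= gD _] : R (exist _ _ PD') (exist _ _ (conj SD QD)).
    apply: maxD; apply/asboolP; split=> //= x Dx.
    by apply: gen_base; left.
  by case: nD; apply: gD; apply: gen_base; right; exists n.
Qed.

End Tower.

(** * From filtrations to liftings *)

Lemma ba_hom_le {dB dC} {B : ctbDistrLatticeType dB} {C : ctbDistrLatticeType dC}
  (f : C -> B) x y : ba_hom f -> x <= y -> f x <= f y.
Proof. by case=> _ fI _ _ _; rewrite !leEmeet -fI => /eqP ->. Qed.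

Section Lifting.
Context {dA dB dC : Order.disp_t} {A : ctbDistrLatticeType dA}
  {B : ctbDistrLatticeType dB} {C : ctbDistrLatticeType dC}.
Variables (g : C -> B) (h : A -> B).
Hypotheses (hg : ba_hom g) (g_onto : forall b, exists c, g c = b) (hh : ba_hom h).

(** The graph of a homomorphism on [D] that lifts [h] through [g]. Single-valuedness follows from
    [lifting_inj] together with meets and complements, by way of [lifting_le]. *)
Record partial_lifting (D : set A) (t : set (A * C)) : Prop := PartialLifting {
  lifting_dom : forall a, D a <-> exists c, t (a, c);
  lifting_bot : t (\bot, \bot);
  lifting_meet : forall a c a' c', t (a, c) -> t (a', c') -> t (a `&` a', c `&` c');
  lifting_compl : forall a c, t (a, c) -> t (~` a, ~` c);
  lifting_inj : forall c, t (\bot, c) -> c = \bot;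
  lifting_comm : forall a c, t (a, c) -> g c = h a }.

Lemma lifting_le D t a c a' c' : partial_lifting D t ->
  t (a, c) -> t (a', c') -> a <= a' -> c <= c'.
Proof.
move=> Qt tac tac' aa'; rewrite -[c']complK; apply/disjP.
apply: (lifting_inj Qt).
suff <- : a `&` ~` a' = \bot.
  by apply: (lifting_meet Qt) => //; apply: (lifting_compl Qt).
by apply/disjP; rewrite complK.
Qed.

(** Sikorski's extension criterion: [w] may serve as image of [z] once it lies above the images of
    all elements of [D] below [z] and below the images of all those above [z]. *)
Lemma partial_lifting_adjoin : extends_to_adjoin partial_lifting.
Proof.
move=> D t z sD rcD Qt; have [_ _ sC] := sD.
have [_ gI gC _ _] := hg; have [_ hI hC _ _] := hh.
have gU x y : g (x `|` y) = g x `|` g y by case: hg.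
have hU x y : h (x `|` y) = h x `|` h y by case: hh.
have [u [Du zu uP]] := rcD z; have [v' [Dv' zv' v'P]] := rcD (~` z).
have [cu tcu] := (lifting_dom Qt u).1 Du.
have [cv tcv] := (lifting_dom Qt _).1 (sC _ Dv').
have [c0 gc0] := g_onto (h z).
(* [u] and [~` v'] are the least upper and greatest lower bound of [z] in [D] *)
pose w := (c0 `|` cv) `&` cu.
have vz : ~` v' <= z by rewrite leCx.
have gw : g w = h z.
  rewrite gI gU gc0 (lifting_comm Qt tcu) (lifting_comm Qt tcv).
  by rewrite (join_l (ba_hom_le hh vz)) (meet_l (ba_hom_le hh zu)).
have w_up a c : t (a, c) -> z <= a -> w <= c.
  move=> tac za; apply: (le_trans (leIr _ _)); apply: (lifting_le Qt tcu tac).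
  by apply: uP => //; apply/(lifting_dom Qt); exists c.
have w_low a c : t (a, c) -> a <= z -> c <= w.
  have Dac : t (a, c) -> D a by move=> ?; apply/(lifting_dom Qt); exists c.
  move=> tac az; rewrite lexI; apply/andP; split.
    apply: lexU2; apply/orP; right; apply: (lifting_le Qt tac tcv).
    by rewrite lexC; apply: v'P; rewrite ?leC //; apply/sC/Dac.
  by apply: (lifting_le Qt tac tcu); apply: le_trans zu.
pose t' : set (A * C) := fun p => exists a b c e,
  [/\ t (a, c), t (b, e) & p = (mix z a b, mix w c e)].
exists t'; split; first by move=> [a c] tac; exists a, a, c, c; rewrite !mix_id.
split.
- move=> x; split.
  + move=> [a [b [/(lifting_dom Qt)[c tac] /(lifting_dom Qt)[e tbe] ->]]].
    by exists (mix w c e), a, b, c, e.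
  + move=> [_ [a [b [c [e [tac tbe [-> _]]]]]]].
    by exists a, b; split=> //; apply/(lifting_dom Qt); [exists c|exists e].
- exists \bot, \bot, \bot, \bot; rewrite !mix_id.
  by have ? := lifting_bot Qt.
- move=> _ _ _ _ [a [b [c [e [tac tbe [-> ->]]]]]] [a' [b' [c' [e' [tac' tbe' [-> ->]]]]]].
  exists (a `&` a'), (b `&` b'), (c `&` c'), (e `&` e'); rewrite !mixI.
  by split=> //; apply: (lifting_meet Qt).
- move=> _ _ [a [b [c [e [tac tbe [-> ->]]]]]].
  exists (~` a), (~` b), (~` c), (~` e); rewrite !mixC.
  by split=> //; apply: (lifting_compl Qt).
- move=> _ [a [b [c [e [tac tbe [m0 ->]]]]]].
  have az : z <= ~` a by apply/disjP; rewrite meetC -(mixIl z a b) -m0 meet0x.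
  have bz : b <= z.
    by rewrite -[z]complK; apply/disjP; rewrite -(mixIr z a b) -m0 meet0x.
  have e0 : e `&` ~` w = \bot by apply/disjP; rewrite complK; apply: w_low tbe _.
  rewrite /mix e0.
  rewrite joinx0 meetC; apply/disjP; apply: w_up az.
  exact: (lifting_compl Qt).
- move=> _ _ [a [b [c [e [tac tbe [-> ->]]]]]].
  rewrite /mix gU (gI c) (gI e) gC gw hU !hI hC.
  by rewrite (lifting_comm Qt tac) (lifting_comm Qt tbe).
Qed.

Lemma partial_lifting_chain : chain_closed partial_lifting.
Proof.
move=> CC [p0 Cp0] tot QCC.
split.
- move=> a; split.
  + by move=> [p Cp /(lifting_dom (QCC _ Cp))[c pac]]; exists c, p.
  + by move=> [c [p Cp pac]]; exists p => //; apply/(lifting_dom (QCC _ Cp)); exists c.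
- by exists p0 => //; apply: lifting_bot (QCC _ Cp0).
- move=> a c a' c' ta ta'; have [p [Cp pa pa']] := stage_chain_pair tot ta ta'.
  by exists p => //; apply: (lifting_meet (QCC _ Cp)).
- by move=> a c [p Cp pa]; exists p => //; apply: (lifting_compl (QCC _ Cp)).
- by move=> c [p Cp pc]; apply: (lifting_inj (QCC _ Cp)).
- by move=> a c [p Cp pc]; apply: (lifting_comm (QCC _ Cp)).
Qed.

(** Nontriviality of [A] keeps the pair [(\top, \top)] from lying over [\bot]. *)
Lemma partial_lifting_bot : nontrivial_ba A ->
  partial_lifting [set x | x = \bot \/ x = \top]%classic
    [set p | p = (\bot, \bot) \/ p = (\top, \top)]%classic.
Proof.
move=> ntA; have [_ _ _ g0 g1] := hg; have [_ _ _ h0 h1] := hh; split.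
- move=> a; split.
    by case=> ->; [exists \bot; left|exists \top; right].
  by case=> c [] [-> _]; [left|right].
- by left.
- move=> a c a' c' [] [-> ->] [] [-> ->]; rewrite !(meetx0, meet0x, meetx1, meet1x);
    by [left|right].
- move=> a c [] [-> ->]; rewrite !(compl0, compl1); by [right|left].
- by move=> c [[->]|[/ntA]].
- by move=> a c [] [-> ->]; rewrite ?g0 ?g1 ?h0 ?h1.
Qed.

Lemma lifting_setT t : partial_lifting setT t ->
  exists2 k : A -> C, ba_hom k & forall a, g (k a) = h a.
Proof.
move=> Qt.
have [k kP] := @choice _ _ (fun a c => t (a, c)) (fun a => (lifting_dom Qt a).1 I).
have kE a c : t (a, c) -> k a = c.
  by move=> tac; apply/le_anti; rewrite !(lifting_le Qt (a := a) (a' := a)).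
have k0 : k \bot = \bot by apply/kE/(lifting_bot Qt).
have kI x y : k (x `&` y) = k x `&` k y by apply/kE/(lifting_meet Qt).
have kC x : k (~` x) = ~` k x by apply/kE/(lifting_compl Qt).
exists k; last by move=> a; apply: (lifting_comm Qt).
split=> //; last by rewrite -compl0 kC k0 compl0.
by move=> x y; rewrite joinE kC kI !kC -joinE.
Qed.

End Lifting.

Lemma filtration_projective d (A : ctbDistrLatticeType d) (SS : set (set A)) :
  nontrivial_ba A -> filtration SS -> projective_ba A.
Proof.
move=> ntA fS dB dC B C _ _ g h hg g_onto hh.
have [|t] := filtration_induction fS _ (partial_lifting_adjoin hg g_onto hh)
  (@partial_lifting_chain _ _ _ _ _ _ g h).
  by eexists; apply: partial_lifting_bot.
exact: lifting_setT.
Qed.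

(** * From filtrations to coherent finite-separation maps *)

Section DisjointJoins.
Context {d : Order.disp_t} {A : ctbDistrLatticeType d}.
Implicit Types (X Y : set A) (F G R : {fset A}).

Definition disjoint_join X (a : A) : Prop :=
  exists F : {fset A},
    [/\ forall x, x \in F -> X x,
        forall x y, x \in F -> y \in F -> x <> y -> x `&` y = \bot
      & a = \join_(x <- F) x].

Lemma disjoint_le x y a b : x <= a -> y <= b -> a `&` b = \bot -> x `&` y = \bot :> A.
Proof. by move=> xa yb ab; apply/eqP; rewrite -lex0 -ab leI2. Qed.

Lemma mem_le_join (r : seq A) x : x \in r -> x <= \join_(y <- r) y.
Proof. by move=> xr; apply: (joins_sup_seq id). Qed.

Lemma disjoint_join_sub X Y a :
  (X `<=` Y)%classic -> disjoint_join X a -> disjoint_join Y a.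
Proof. by move=> XY [F [FX Fd ->]]; exists F; split=> // x /FX /XY. Qed.

Lemma disjoint_joinU X a b : disjoint_join X a -> disjoint_join X b ->
  a `&` b = \bot -> disjoint_join X (a `|` b).
Proof.
move=> [F [FX Fd ->]] [G [GX Gd ->]] FG0; exists (F `|` G)%fset.
have FG x y : x \in F -> y \in G -> x `&` y = \bot.
  by move=> xF yG; apply: disjoint_le FG0; apply: mem_le_join.
split.
- by move=> x /fsetUP[/FX|/GX].
- move=> x y /fsetUP[xF|xG] /fsetUP[yF|yG] xy; [exact: Fd|exact: FG| |exact: Gd].
  by rewrite meetC FG.
- apply/le_anti/andP; split.
    by rewrite leUx; apply/andP; split; apply/joinsP_seq => x xF _;
      apply: mem_le_join; apply/fsetUP; [left|right].
  apply/joinsP_seq => x /fsetUP[] xF _; apply: lexU2.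
    by rewrite (mem_le_join xF).
  by rewrite (mem_le_join xF) orbT.
Qed.

Lemma disjoint_join_bigjoin X R (f : A -> A) :
  (forall x y, x \in R -> y \in R -> x <> y -> x `&` y = \bot) ->
  (forall x, x \in R -> f x <= x /\ disjoint_join X (f x)) ->
  disjoint_join X (\join_(x <- R) f x).
Proof.
move=> Rd Rf.
have /choice[F FP] x : exists G : {fset A}, x \in R ->
    [/\ forall y, y \in G -> X y,
        forall y z, y \in G -> z \in G -> y <> z -> y `&` z = \bot
      & f x = \join_(y <- G) y].
  have [xR|xR] := boolP (x \in R); last by exists fset0.
  by have [_ [G GP]] := Rf x xR; exists G.
have Fle x y : x \in R -> y \in F x -> y <= f x.
  by move=> xR yF; have [_ _ ->] := FP x xR; apply: mem_le_join.
exists (\bigcup_(x <- R) F x)%fset; split.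
- by move=> y /bigfcupP[x /andP[xR _] yF]; have [h _ _] := FP x xR; apply: h.
- move=> y z /bigfcupP[x /andP[xR _] yF] /bigfcupP[x' /andP[xR' _] zF] yz.
  have [e|/eqP e] := eqVneq x x'.
    by subst x'; have [_ h _] := FP x xR; apply: h.
  apply: disjoint_le (Rd _ _ xR xR' e).
    by apply: le_trans (Fle _ _ xR yF) _; have [] := Rf x xR.
  by apply: le_trans (Fle _ _ xR' zF) _; have [] := Rf x' xR'.
- apply/le_anti/andP; split; apply/joinsP_seq.
    move=> x xR _; have [_ _ ->] := FP x xR; apply/joinsP_seq => y yF _.
    apply: mem_le_join => //; apply/bigfcupP; exists x => //.
    by rewrite xR.
  move=> y /bigfcupP[x /andP[xR _] yF] _; apply: le_trans (Fle _ _ xR yF) _.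
  exact: joins_sup_seq.
Qed.

(** The bound [x <= a] is passed to the hypothesis because a base element yields a new one only if
    it lies below a part of the splitting. *)
Lemma disjoint_join_meet X Y a w : (forall x, X x -> x <= a -> Y (x `&` w)) ->
  disjoint_join X a -> disjoint_join Y (a `&` w).
Proof.
move=> XY [F [FX Fd aE]]; have Fa x : x \in F -> x <= a.
  by move=> xF; rewrite aE; apply: mem_le_join.
exists [fset (x `&` w)%O | x in F]%fset; split.
- by move=> _ /imfsetP[x /= xF ->]; apply: XY; [apply: FX|apply: Fa].
- move=> _ _ /imfsetP[x /= xF ->] /imfsetP[y /= yF ->] xy.
  apply: (disjoint_le (leIl _ _) (leIl _ _)); apply: Fd => //.
  by move=> e; apply: xy; rewrite e.
- apply/le_anti/andP; split.
    rewrite aE joins_meetl; apply/joinsP_seq => x xF _.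
    by apply: mem_le_join; apply/imfsetP; exists x.
  apply/joinsP_seq => _ /imfsetP[x /= xF ->] _; rewrite leI2 //; exact: Fa.
Qed.

Lemma meet_closure_sub F G x : (F `<=` G)%fset -> meet_closure F x -> meet_closure G x.
Proof.
by move=> FG [x0 [H [H0 HF xE]]]; split=> //; exists H; split=> //; apply: fsubset_trans FG.
Qed.

Lemma mem_meet_closure F x : x \in F -> x <> \bot -> meet_closure F x.
Proof.
move=> xF x0; split=> //; exists [fset x]%fset; rewrite big_seq_fset1.
split=> //; last by rewrite fsub1set.
by move=> e; have := fset11 x; rewrite e.
Qed.

End DisjointJoins.

Section SeparatedBase.
Context {d : Order.disp_t} {A : ctbDistrLatticeType d}.
Implicit Types (D : set A) (t : set (A * {fset A})).

(* [t] is the graph of a coherent finite-separation map on a base of [D] *)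
Record separated_base D t : Prop := SeparatedBase {
  sb_fun : forall x F G, t (x, F) -> t (x, G) -> F = G;
  sb_neq0 : forall x F, t (x, F) -> x <> \bot;
  sb_sub : forall x F, t (x, F) -> D x;
  sb_val : forall x F y, t (x, F) -> y \in F -> exists G, t (y, G);
  sb_meet : forall x F y G, t (x, F) -> t (y, G) -> x `&` y <> \bot ->
    exists2 H, t (x `&` y, H) & forall u, u \in H -> meet_closure (F `|` G)%fset u;
  sb_sep : forall x F y G, t (x, F) -> t (y, G) -> x `&` y = \bot ->
    exists c e, [/\ c \in (F `&` G)%fset, e \in (F `&` G)%fset,
                    c `&` e = \bot, x <= c & y <= e];
  sb_base : forall a, D a -> disjoint_join [set x | exists F, t (x, F)]%classic a }.

Lemma separated_base_adjoin : extends_to_adjoin separated_base.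
Proof.
move=> D t z sD rcD Qt; have [_ sI sC] := sD.
have [u [Du zu uP]] := rcD z; have [v [Dv zv vP]] := rcD (~` z).
(* [z] splits [r]: a nonzero element of [D] below [r] meets both [z] and [~` z],
   whereas [D] already decides [z] outside [r] (see [zr] and [zr'] below) *)
pose r := u `&` v; have Dr : D r by apply: sI.
have [R [Rt Rd rE]] := sb_base Qt Dr.
have Rr x : x \in R -> x <= r by move=> xR; rewrite rE; apply: mem_le_join.
pose w b := if b then z else ~` z.
have wN b : w (~~ b) = ~` w b by case: b => //=; rewrite complK.
have split0 b p : D p -> p <= r -> p `&` w b = \bot -> p = \bot.
  move=> Dp pr /disjP pw; apply: lex_disj (lexx p) _.
  apply: le_trans pr _; rewrite lexC; case: b pw => /= pw.
    rewrite lexC; apply: le_trans (leIl _ _) _; apply: uP; first exact: sC.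
    by rewrite lexC.
  rewrite lexC; apply: le_trans (leIr _ _) _; apply: vP; first exact: sC.
  by rewrite leC -[z]complK.
have split_le b p q : D p -> D q -> p <= r -> p `&` w b <= q -> p <= q.
  move=> Dp Dq pr pq; rewrite -[q]complK; apply/disjP; apply: (@split0 b).
  - by apply: sI => //; apply: sC.
  - exact: le_trans (leIl _ _) pr.
  - by rewrite meetAC; apply/disjP; rewrite complK.
(* These are the values added to [s]: the two halves of a part separate new elements that lie in
   this part on opposite sides of [z]. *)
pose halves x : {fset A} := [fset (x `&` z)%O; (x `&` ~` z)%O]%fset.
have halvesP b x : x `&` w b \in halves x by case: b; rewrite !inE eqxx ?orbT.
pose new (q : A * {fset A}) := exists b p F x,
  [/\ t (p, F), x \in R, p <= x & q = (p `&` w b, (F `|` halves x)%fset)].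
pose t' : set (A * {fset A}) := fun q => t q \/ new q.
have Dt p F : t (p, F) -> D p by apply: sb_sub.
have new0 b p F : t (p, F) -> p <= r -> p `&` w b <> \bot.
  move=> tp pr pw; apply: (sb_neq0 Qt tp); apply: split0 pw => //; exact: Dt tp.
(* No new element is old: it would be an element of [D] below [r] that misses the opposite side of
   [z], hence zero by [split0]. *)
have fun_new_old b p F q G : t (p, F) -> p <= r -> t (q, G) -> p `&` w b <> q.
  move=> tp pr tq e; apply: (sb_neq0 Qt tq); apply: (@split0 (~~ b)).
  - exact: Dt tq.
  - by rewrite -e; apply: le_trans (leIl _ _) pr.
  - by rewrite wN -e -meetA meetxC meetx0.
have le_r p x : x \in R -> p <= x -> p <= r by move=> /Rr xr px; apply: le_trans xr.
(* The parts are disjoint and [p] is nonzero, so [p] determines its part and hence the value of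
   [s]. *)
have same_part p F x y : t (p, F) -> x \in R -> y \in R -> p <= x -> p <= y -> x = y.
  move=> tp xR yR px py; apply: contrapT => xy; apply: (sb_neq0 Qt tp).
  by apply/eqP; rewrite -lex0 -(Rd _ _ xR yR xy) lexI px.
exists t'; split; first by left.
split.
- move=> x F G [tF|[b [p [F1 [y [tp yR py [-> ->]]]]]]].
    move=> [tG|[b [p [F1 [y [tp yR py [e _]]]]]]]; first exact: (sb_fun Qt tF tG).
    by case: (fun_new_old b p F1 x F tp (le_r _ _ yR py) tF).
  have pr := le_r _ _ yR py.
  move=> [tG|[b' [q [G1 [y' [tq yR' qy [e ->]]]]]]].
    by case: (fun_new_old b p F1 _ G tp pr tG).
  have qr := le_r _ _ yR' qy.
  have [eb|nb] := eqVneq b b'; last first.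
    case: (new0 b p F1 tp pr); apply: lex_disj (leIr (w b) p) _.
    have bb : b' = ~~ b by case: (b) (b') nb => [] [].
    by rewrite e bb wN leIr.
  (* An element of [D] below [r] is recovered from either of its halves, by [split_le]. *)
  subst b'; have pq : p = q.
    apply/le_anti; rewrite (@split_le b p q) ?(@split_le b q p) //.
    all: try (by apply: Dt; eassumption).
    + by rewrite -e leIl.
    + by rewrite e leIl.
  subst q; rewrite (sb_fun Qt tp tq).
  by rewrite (same_part _ _ _ _ tp yR yR' py qy).
- move=> x F [|[b [p [F1 [y [tp yR py [-> _]]]]]]]; first exact: (sb_neq0 Qt).
  exact: (new0 _ _ _ tp (le_r _ _ yR py)).
- have [_ aI aC] := subalg_adjoin z sD; have az := adjoin_self z sD.
  move=> x F [/Dt|[b [p [F1 [y [tp yR py [-> _]]]]]]]; first exact: sub_adjoin.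
  apply: aI; first by apply: sub_adjoin; apply: Dt tp.
  by case: b => //=; apply: aC.
- move=> x F y [tx|[b [p [F1 [c [tp cR pc [_ ->]]]]]]].
    by move=> /(sb_val Qt tx)[G tG]; exists G; left.
  move=> /fsetUP[/(sb_val Qt tp)[G tG]|]; first by exists G; left.
  (* The halves of [c] are new elements themselves, with [p] and the part both equal to [c]. *)
  have [G tc] := Rt _ cR.
  rewrite !inE => /orP[] /eqP ->; exists (G `|` halves c)%fset; right.
    by exists true, c, G, c.
  by exists false, c, G, c.
(* A new element met with an old one stays in the same part. Its value consists of members obtained
   from the old coherence and of halves that the new element already carries. *)
- have new_old b p F x q G : t (p, F) -> x \in R -> p <= x -> t (q, G) ->
      (p `&` w b) `&` q <> \bot -> exists2 H, t' ((p `&` w b) `&` q, H) &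
      forall u, u \in H -> meet_closure (F `|` halves x `|` G)%fset u.
    move=> tp xR px tq; rewrite meetAC => pq0.
    have [|H tH HP] := sb_meet Qt tp tq.
      by move=> e; apply: pq0; rewrite e meet0x.
    exists (H `|` halves x)%fset.
      by right; exists b, (p `&` q), H, x; split=> //; apply: le_trans px; apply: leIl.
    move=> c /fsetUP[/HP|cx].
      by apply: meet_closure_sub; rewrite fsetUSS // fsubsetUl.
    have [Fx tx] := Rt _ xR.
    apply: mem_meet_closure; first by apply/fsetUP; left; apply/fsetUP; right.
    by move: cx; rewrite !inE => /orP[] /eqP ->;
      [apply: (new0 true)|apply: (new0 false)]; try exact: tx; apply: Rr.
  move=> x F y G [tx|[b [p [F1 [c [tp cR pc [-> ->]]]]]]].
    move=> [ty|[b [p [F1 [c [tp cR pc [-> ->]]]]]]].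
      by move=> /(sb_meet Qt tx ty)[H tH HP]; exists H => //; left.
    by rewrite meetC fsetUC; apply: new_old.
  move=> [ty|[b' [q [G1 [c' [tq cR' qc [-> ->]]]]]]]; first exact: new_old.
  move=> pq0.
  have eb : b = b'.
    apply/eqP/negPn/negP => nb; apply: pq0; have -> : b' = ~~ b by case: (b) (b') nb => [] [].
    by rewrite wN; apply: disjoint_le (leIr _ _) (leIr _ _) (meetxC _).
  subst b'.
  (* On a common side the second factor may be replaced by the old element [q], which reduces to the
     mixed case. *)
  have -> : (p `&` w b) `&` (q `&` w b) = (p `&` w b) `&` q.
    by rewrite meetACA meetxx meetAC.
  have [|H tH HP] := new_old b p F1 c q G1 tp cR pc tq.
    by move=> e; apply: pq0; rewrite meetA e meet0x.
  exists H => // a /HP; apply: meet_closure_sub.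
  by rewrite fsetUSS // fsubsetUl.
(* By [split0], disjointness on one side of [z] forces [p] and [q] to be disjoint, so the old
   separating pair works. *)
- have new_old b p F x q G : t (p, F) -> x \in R -> p <= x -> t (q, G) ->
      (p `&` w b) `&` q = \bot ->
      exists c e, [/\ c \in ((F `|` halves x) `&` G)%fset,
        e \in ((F `|` halves x) `&` G)%fset, c `&` e = \bot, p <= c & q <= e].
    move=> tp xR px tq; rewrite meetAC => pq0.
    have {}pq0 : p `&` q = \bot.
      apply: split0 pq0; first by apply: sI; apply: Dt; eassumption.
      exact: le_trans (leIl _ _) (le_r _ _ xR px).
    have [c [e [/fsetIP[cF cG] /fsetIP[eF eG] ce pc qe]]] := sb_sep Qt tp tq pq0.
    by exists c, e; split=> //; rewrite in_fsetI in_fsetU ?cF ?eF ?cG.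
  move=> x F y G [tx|[b [p [F1 [c [tp cR pc [-> ->]]]]]]].
    move=> [ty|[b [p [F1 [c [tp cR pc [-> ->]]]]]]]; first exact: (sb_sep Qt).
    rewrite meetC fsetIC => /(new_old _ _ _ _ _ _ tp cR pc tx)[e [f [h1 h2 h3 h4 h5]]].
    exists f, e; split=> //; first by rewrite meetC.
    by apply: le_trans (leIl _ _) h4.
  move=> [ty|[b' [q [G1 [c' [tq cR' qc [-> ->]]]]]]].
    move=> /(new_old _ _ _ _ _ _ tp cR pc ty)[e [f [h1 h2 h3 h4 h5]]].
    by exists e, f; split=> //; apply: le_trans (leIl _ _) h4.
  (* Either the old elements are disjoint and their separating pair serves, or they meet. In the
     latter case they share a part and lie on opposite sides, and the halves of that part separate
     them. *)
  move=> pq0; have [pq|pq] := pselect (p `&` q = \bot).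
    have [e [f [/fsetIP[eF eG] /fsetIP[fF fG] ef pe qf]]] := sb_sep Qt tp tq pq.
    exists e, f; rewrite !in_fsetI !in_fsetU eF eG fF fG; split=> //.
      exact: le_trans (leIl _ _) pe.
    exact: le_trans (leIl _ _) qf.
  have [H tH _] := sb_meet Qt tp tq pq.
  have ec : c = c'.
    by apply: (same_part _ _ _ _ tH) => //; [apply: le_trans pc; apply: leIl|
      apply: le_trans qc; apply: leIr].
  subst c'; have nb : b' = ~~ b.
    suff : b != b' by case: (b) (b') => [] [].
    apply/eqP => eb; subst b'; apply: (new0 b _ _ tH).
      by apply: le_r cR _; apply: le_trans pc; apply: leIl.
    by rewrite -pq0 meetACA meetxx.
  have hU b1 K : c `&` w b1 \in (K `|` halves c)%fset by apply/fsetUP; right.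
  subst b'; exists (c `&` w b), (c `&` w (~~ b)); split.
  + by apply/fsetIP; split; apply: hU.
  + by apply/fsetIP; split; apply: hU.
  + by rewrite wN; apply: disjoint_le (leIr _ _) (leIr _ _) (meetxC _).
  + exact: leI2.
  + exact: leI2.
(* Below [r], an element of [D] is cut along the parts, decomposed in the old base inside each part,
   and then restricted to one side. *)
- have djw b p : D p ->
      disjoint_join [set x | exists F, t' (x, F)]%classic (p `&` r `&` w b).
    move=> Dp; rewrite rE [p `&` _]meetC -meetA joins_meetl.
    apply: disjoint_join_bigjoin => // x xR; split; first exact: leIl.
    have [Fx tx] := Rt _ xR.
    rewrite meetA [x `&` p]meetC; apply: disjoint_join_meet (sb_base Qt (sI _ _ Dp (Dt _ _ tx))).
    move=> y [Fy ty] yx; exists (Fy `|` halves x)%fset; right.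
    by exists b, y, Fy, x; split=> //; apply: le_trans yx (leIr _ _).
  move=> _ [a [b [Da Db ->]]].
  (* The element is cut along [r]: off [r] it belongs to [D], and below [r] its two sides are
     handled by [djw]. *)
  rewrite -[mix z a b](mix_id r) /mix; apply: disjoint_joinU; last first.
  + exact: disjoint_le (leIr _ _) (leIr _ _) (meetxC _).
  + apply: (@disjoint_join_sub _ _ [set x | exists F, t (x, F)]%classic).
      by move=> x [F tx]; exists F; left.
    apply: (sb_base Qt).
    have -> : (a `&` z `|` b `&` ~` z) `&` ~` r = (a `&` ~` v) `|` (b `&` ~` u).
      have zr : z `&` ~` r = ~` v.
        rewrite complI meetUr; have /disjP -> : z <= ~` (~` u) by rewrite complK.
        by rewrite join0x; apply: meet_r; rewrite leCx.
      have zr' : ~` z `&` ~` r = ~` u.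
        rewrite complI meetUr; have /disjP -> : ~` z <= ~` (~` v) by rewrite complK.
        by rewrite joinx0; apply: meet_r; rewrite leC.
      by rewrite meetUl -!meetA zr zr'.
    by apply: subalgU => //; apply: sI => //; apply: sC.
  + have -> : (a `&` z `|` b `&` ~` z) `&` r =
        (a `&` r `&` w true) `|` (b `&` r `&` w false).
      by rewrite meetUl [a `&` z `&` r]meetAC [b `&` _ `&` r]meetAC.
    apply: disjoint_joinU; [exact: djw|exact: djw|].
    by rewrite (wN true); apply: disjoint_le (leIr _ _) (leIr _ _) (meetxC _).
Qed.

Lemma separated_base_chain : chain_closed separated_base.
Proof.
move=> CC [p0 Cp0] tot QCC.
split.
- move=> x F G xF xG; have [p [Cp pF pG]] := stage_chain_pair tot xF xG.
  exact: (sb_fun (QCC _ Cp) pF pG).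
- by move=> x F [p Cp pF]; apply: (sb_neq0 (QCC _ Cp) pF).
- by move=> x F [p Cp pF]; exists p => //; apply: (sb_sub (QCC _ Cp) pF).
- by move=> x F y [p Cp pF] /(sb_val (QCC _ Cp) pF)[G pG]; exists G, p.
- move=> x F y G xF yG; have [p [Cp pF pG]] := stage_chain_pair tot xF yG.
  by move=> /(sb_meet (QCC _ Cp) pF pG)[H pH HP]; exists H => //; exists p.
- move=> x F y G xF yG; have [p [Cp pF pG]] := stage_chain_pair tot xF yG.
  exact: (sb_sep (QCC _ Cp) pF pG).
- move=> a [p Cp /(sb_base (QCC _ Cp))]; apply: disjoint_join_sub => x [F pF].
  by exists F, p.
Qed.

(** The base is [\top] alone, and it may take the empty value since it is not disjoint from itself;
    [\bot] is the empty join. *)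
Lemma separated_base_bot : nontrivial_ba A ->
  separated_base [set x | x = \bot \/ x = \top]%classic
    [set q | q = (\top, fset0)]%classic.
Proof.
move=> ntA; split.
- by move=> x F G [_ ->] [_ ->].
- by move=> x F [-> _] /esym.
- by move=> x F [-> _]; right.
- by move=> x F y [_ ->].
- by move=> x F y G [-> ->] [-> ->] _; exists fset0; rewrite ?meetxx.
- by move=> x F y G [-> _] [-> _]; rewrite meetxx => /esym.
- move=> a [] ->; [exists fset0|exists [fset \top]%fset]; split.
  + by [].
  + by [].
  + by rewrite big_seq_fset0.
  + by move=> x /fset1P ->; exists fset0.
  + by move=> x y /fset1P -> /fset1P ->.
  + by rewrite big_seq_fset1.
Qed.

Lemma separated_base_setT t : separated_base setT t ->
  exists X : set A,
    [/\ base X, closed_nonzero_meet X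
      & exists s : A -> {fset A}, coherent_finite_separation X s].
Proof.
move=> Qt; exists [set x | exists F, t (x, F)]%classic.
have /choice[s sP] x : exists F, forall G, t (x, G) -> F = G.
  have [[F tF]|n] := pselect (exists F, t (x, F)).
    by exists F => G; apply: (sb_fun Qt).
  (* The default value outside the base. *)
  by exists fset0 => G tG; case: n; exists G.
split.
- split; first by move=> x [F]; apply: (sb_neq0 Qt).
  by move=> a _; apply: (sb_base Qt).
- by move=> a b [F ta] [G tb] /(sb_meet Qt ta tb)[H tH _]; exists H.
- exists s; split; first split.
  + by move=> a [F ta] x; rewrite (sP _ _ ta); apply: (sb_val Qt ta).
  + move=> a b [F ta] [G tb] ab; rewrite (sP _ _ ta) (sP _ _ tb).
    exact: (sb_sep Qt ta tb).
  + move=> a b [F ta] [G tb]; rewrite lt0x => /eqP ab.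
    have [H tH HP] := sb_meet Qt ta tb ab.
    by rewrite (sP _ _ ta) (sP _ _ tb) (sP _ _ tH).
Qed.

End SeparatedBase.

Lemma filtration_separation d (A : ctbDistrLatticeType d) (SS : set (set A)) :
  nontrivial_ba A -> filtration SS ->
  exists X : set A,
    [/\ base X, closed_nonzero_meet X
      & exists s : A -> {fset A}, coherent_finite_separation X s].
Proof.
move=> ntA fS.
have [|t] := filtration_induction fS _ (@separated_base_adjoin _ A)
  (@separated_base_chain _ A); first by eexists; apply: separated_base_bot.
exact: separated_base_setT.
Qed.

(** * From projectivity to filtrations *)

Section Closure.
Context {d : Order.disp_t} {A : ctbDistrLatticeType d}.
Local Open Scope classical_set_scope.

Lemma subalg_chain (FF : set (set A)) : (forall D, FF D -> subalg D) ->
  FF !=set0 -> total_on FF subset -> subalg (\bigcup_(D in FF) D).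
Proof.
move=> sFF [D0 FD0] tot; split.
- by exists D0 => //; have [] := sFF _ FD0.
- move=> a b [D FD Da] [E FE Eb].
  have [DE|ED] := tot D E FD FE.
    by exists E => //; have [_ sI _] := sFF _ FE; apply: sI => //; apply: DE.
  by exists D => //; have [_ sI _] := sFF _ FD; apply: sI => //; apply: ED.
- by move=> a [D FD Da]; exists D => //; have [_ _ sC] := sFF _ FD; apply: sC.
Qed.

Lemma subalg_bot : subalg [set x : A | x = \bot \/ x = \top].
Proof.
split; first by left.
- by move=> a b [] -> [] ->; rewrite !(meet0x, meetx0, meetxx); by [left|right].
- by move=> a [] ->; rewrite !(compl0, compl1); by [left|right].
Qed.

End Closure.

(** Finitely many elements are reached from [x] in each number of steps, so all reachable ones can
    be listed in a sequence, possibly with repetitions. *)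
Lemma countable_closure (T : choiceType) (X : set T) (Phi : T -> {fset T}) x :
  X x -> (forall y u, X y -> u \in Phi y -> X u) ->
  exists z : nat -> T, [/\ forall n, X (z n), exists n, z n = x &
    forall n u, u \in Phi (z n) -> exists m, z m = u].
Proof.
move=> Xx XPhi.
pose L := fix L n := if n is m.+1 then flatten [seq (Phi y : seq T) | y <- L m]
  else [:: x].
(* A number codes a level and a position in it; invalid codes and positions fall back to [x]. *)
pose z m := if @choice.unpickle (nat * nat)%type m is Some (n, i) then nth x (L n) i else x.
have zL n u : u \in L n -> exists m, z m = u.
  move=> uL; exists (choice.pickle (n, index u (L n))).
  by rewrite /z choice.pickleK nth_index.
have XL n u : u \in L n -> X u.
  elim: n u => [|n IH] u; first by rewrite inE => /eqP->.
  by move=> /flatten_mapP[y /IH Xy]; apply: XPhi.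
have Lz m : exists n, z m \in L n.
  rewrite /z; case: (choice.unpickle _) => [[n i]|]; last first.
    by exists 0; rewrite inE.
  have [iL|iL] := ltnP i (size (L n)); first by exists n; apply: mem_nth.
  by exists 0; rewrite nth_default // inE.
exists z; split.
- by move=> m; have [n /XL] := Lz m.
- by apply: (zL 0); rewrite inE.
- move=> m u uP; have [n zn] := Lz m.
  by apply: (zL n.+1); apply/flatten_mapP; exists (z m).
Qed.

(** * Free Boolean algebras and elimination of generators *)

Section FreeAlgebra.
Context {d : Order.disp_t} (A : ctbDistrLatticeType d).
Implicit Types (f : (A -> A) -> A) (p q : A -> A) (S D : set A).

Inductive bool_poly : ((A -> A) -> A) -> Prop :=
| bool_poly_var x : bool_poly (fun p => p x)
| bool_poly_bot : bool_poly (fun=> \bot)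
| bool_poly_meet f g : bool_poly f -> bool_poly g -> bool_poly (fun p => f p `&` g p)
| bool_poly_compl f : bool_poly f -> bool_poly (fun p => ~` f p).

Lemma bool_poly_join f g :
  bool_poly f -> bool_poly g -> bool_poly (fun p => f p `|` g p).
Proof.
move=> bf bg; under eq_fun do rewrite joinE.
by apply/bool_poly_compl/bool_poly_meet; apply: bool_poly_compl.
Qed.

Lemma bool_poly_top : bool_poly (fun=> \top).
Proof. by rewrite -compl0; apply/bool_poly_compl/bool_poly_bot. Qed.

(* By evaluation at the generators, the Boolean functions [(A -> A) -> A]
   generated by the projections form the free Boolean algebra on the set [A]. *)
Definition free_ba := {f | bool_poly f}.
HB.instance Definition _ := gen_eqMixin free_ba.
HB.instance Definition _ := gen_choiceMixin free_ba.
Implicit Types (u v w : free_ba).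

Lemma free_ba_eq u v : (forall p, sval u p = sval v p) -> u = v.
Proof. by case: u v => [f bf] [g bg] /= /funext e; apply: eq_exist. Qed.

Definition free_meet u v : free_ba :=
  exist _ _ (bool_poly_meet (proj2_sig u) (proj2_sig v)).
Definition free_join u v : free_ba :=
  exist _ _ (bool_poly_join (proj2_sig u) (proj2_sig v)).
Definition free_compl u : free_ba := exist _ _ (bool_poly_compl (proj2_sig u)).
Definition free_bot : free_ba := exist _ _ bool_poly_bot.
Definition free_top : free_ba := exist _ _ bool_poly_top.
Definition free_var x : free_ba := exist _ _ (bool_poly_var x).
Definition free_le u v := free_meet u v == u.
Definition free_lt u v := (v != u) && free_le u v.

Lemma free_meetC : commutative free_meet.
Proof. by move=> u v; apply: free_ba_eq => p; apply: meetC. Qed.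
Lemma free_joinC : commutative free_join.
Proof. by move=> u v; apply: free_ba_eq => p; apply: joinC. Qed.
Lemma free_meetA : associative free_meet.
Proof. by move=> u v w; apply: free_ba_eq => p; apply: meetA. Qed.
Lemma free_joinA : associative free_join.
Proof. by move=> u v w; apply: free_ba_eq => p; apply: joinA. Qed.
Lemma free_joinKI v u : free_meet u (free_join u v) = u.
Proof. by apply: free_ba_eq => p; apply: joinKI. Qed.
Lemma free_meetKU v u : free_join u (free_meet u v) = u.
Proof. by apply: free_ba_eq => p; apply: meetKU. Qed.
Lemma free_meetUl : left_distributive free_meet free_join.
Proof. by move=> u v w; apply: free_ba_eq => p; apply: meetUl. Qed.
Lemma free_meetxx : idempotent_op free_meet.
Proof. by move=> u; apply: free_ba_eq => p; apply: meetxx. Qed.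

HB.instance Definition _ := Order.isMeetJoinDistrLattice.Build d free_ba
  (le := free_le) (lt := free_lt) (fun _ _ => erefl) (fun _ _ => erefl)
  free_meetC free_joinC free_meetA free_joinA free_joinKI free_meetKU
  free_meetUl free_meetxx.

Lemma free_le0x u : (free_bot : free_ba) <= u.
Proof. by apply/eqP/free_ba_eq => p; apply: meet0x. Qed.
Lemma free_lex1 u : u <= (free_top : free_ba).
Proof. by apply/eqP/free_ba_eq => p; apply: meetx1. Qed.

HB.instance Definition _ := Order.hasBottom.Build d free_ba free_le0x.
HB.instance Definition _ := Order.hasTop.Build d free_ba free_lex1.

Lemma free_joinxC u : u `|` free_compl u = \top.
Proof. by apply: free_ba_eq => p; apply: joinxC. Qed.
Lemma free_meetxC u : u `&` free_compl u = \bot.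
Proof. by apply: free_ba_eq => p; apply: meetxC. Qed.

HB.instance Definition _ :=
  Order.TBDistrLattice_hasComplement.Build d free_ba free_joinxC free_meetxC.

Lemma ba_hom_eval (p : A -> A) : ba_hom (fun u : free_ba => sval u p).
Proof. by []. Qed.

Definition depends_on S f : Prop :=
  forall p q, (forall x, S x -> p x = q x) -> f p = f q.

Lemma depends_on_sub S S' f : (S `<=` S')%classic -> depends_on S f -> depends_on S' f.
Proof. by move=> SS' Sf p q pq; apply: Sf => x /SS'; apply: pq. Qed.

Lemma bool_poly_finite_support f : bool_poly f ->
  exists F : {fset A}, depends_on [set` F] f.
Proof.
elim=> [x||g h _ [F Fg] _ [G Gh]|g _ [F Fg]].
- by exists [fset x]%fset => p q; apply; rewrite /= fset11.
- by exists fset0.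
- exists (F `|` G)%fset => p q pq; rewrite (Fg p q) ?(Gh p q) // => x xF;
    by apply: pq; rewrite /= in_fsetU xF ?orbT.
- by exists F => p q /Fg ->.
Qed.

Definition upd p (x c : A) : A -> A := fun y => if y == x then c else p y.

Lemma bool_poly_upd f x c : bool_poly (fun=> c) -> bool_poly f ->
  bool_poly (fun p => f (upd p x c)).
Proof.
move=> bc; elim=> [y||g h _ bg _ bh|g _ bg].
- by rewrite /upd; case: (y == x) => //; apply: bool_poly_var.
- exact: bool_poly_bot.
- exact: bool_poly_meet bg bh.
- exact: bool_poly_compl bg.
Qed.

(** Shannon expansion: relative to [e], the value of a Boolean polynomial depends only on the
    arguments relative to [e]. *)
Lemma bool_poly_shannon f p x c e : bool_poly f -> p x `&` e = c `&` e ->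
  f p `&` e = f (upd p x c) `&` e.
Proof.
move=> bf pc; elim: bf => [y|//|g h _ eg _ eh|g _ eg].
- by rewrite /upd; case: (eqVneq y x) => [->|].
- have E a b : (a `&` b) `&` e = (a `&` e) `&` (b `&` e) by rewrite meetACA meetxx.
  by rewrite !E eg eh.
- exact: compl_meetr.
Qed.

Lemma le_quantify f p x : bool_poly f ->
  f p <= f (upd p x \top) `|` f (upd p x \bot).
Proof.
move=> bf; apply: (@le_split _ _ (p x)).
  by rewrite (@bool_poly_shannon f p x \top) ?meet1x ?meetxx // lexU2 // leIl.
by rewrite (@bool_poly_shannon f p x \bot) ?meet0x ?meetxC // lexU2 // leIl orbT.
Qed.

(** Generators outside [D] are eliminated one at a time: the join of the two cofactors [x := \top]
    and [x := \bot] is the existential quantification of [f] over [x], its least upper bound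
    independent of [x]. *)
Lemma upper_projection D (r : seq A) f : bool_poly f ->
  depends_on (D `|` [set` r])%classic f ->
  exists f', [/\ bool_poly f', depends_on D f', forall p, f p <= f' p &
    forall h, depends_on D h -> (forall p, f p <= h p) -> forall p, f' p <= h p].
Proof.
elim: r f => [|x r IH] f bf Df.
  by exists f; split=> //; apply: depends_on_sub Df => y [|].
have [Dx|Dx] := pselect (D x).
  apply: IH => //; apply: depends_on_sub Df => y [Dy|]; first by left.
  by rewrite /= inE => /orP[/eqP->|yr]; [left|right].
have [||f' [bf' Df' ff' f'P]] := IH (fun p => f (upd p x \top) `|` f (upd p x \bot)).
- by apply: bool_poly_join; apply: bool_poly_upd => //;
    [apply: bool_poly_top|apply: bool_poly_bot].
- move=> p q pq; congr (_ `|` _); apply: Df => y Dy; rewrite /upd;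
    case: eqVneq => // /eqP yx; apply: pq.
  + by case: Dy => [|/=]; [left|rewrite inE => /orP[/eqP|]//; right].
  + by case: Dy => [|/=]; [left|rewrite inE => /orP[/eqP|]//; right].
exists f'; split=> //; first by move=> p; apply: le_trans (ff' p); apply: le_quantify.
move=> h Dh fh; apply: f'P => // p.
(* Since [h] ignores [x], its bound at the two updated points is a bound by [h p] on both
   cofactors. *)
have hx c : h (upd p x c) = h p.
  by apply: Dh => y Dy; rewrite /upd; case: eqVneq => // yx; rewrite yx in Dy.
by rewrite leUx -{1}(hx \top) -(hx \bot) !fh.
Qed.

Lemma subalg_bool_poly D f p : subalg D -> bool_poly f -> (forall x, D (p x)) -> D (f p).
Proof. by case=> D0 DI DC bf Dp; elim: bf; auto. Qed.

End FreeAlgebra.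

Section ProjectiveFiltration.
Context {d : Order.disp_t} {A : ctbDistrLatticeType d}.
Variable k : A -> free_ba A.
Hypotheses (hk : ba_hom k) (kK : forall a, sval (k a) id = a).
Local Open Scope classical_set_scope.

Definition stable_subalg (D : set A) : Prop :=
  subalg D /\ forall x, D x -> depends_on D (sval (k x)).

(** For relative completeness, [k a] is projected to the generators in [D] and the result is
    evaluated at [id], which brings it back to [A]. *)
Lemma stable_subalg_filtration : filtration stable_subalg.
Proof.
have [_ kI kC k0 k1] := hk.
have k_le a b p : a <= b -> sval (k a) p <= sval (k b) p.
  rewrite !leEmeet => /eqP ab; apply/eqP; rewrite -[in RHS]ab kI; exact: erefl.
split.
- by split; [exact: subalg_bot|move=> x [] ->; rewrite ?k0 ?k1].
- by move=> D [].
- move=> D [sD kD] a; have [F Fa] := bool_poly_finite_support (proj2_sig (k a)).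
  have [|f [bf Df af fP]] := @upper_projection _ _ D F _ (proj2_sig (k a)).
    by apply: depends_on_sub Fa => x; right.
  exists (f id); split.
  (* As [f] only reads arguments in [D], [id] can be replaced by a point with all values in [D]. *)
  + pose p x := if `[< D x >] then x else \bot.
    rewrite (Df id p); last by move=> x Dx; rewrite /p asboolT.
    apply: (subalg_bool_poly sD bf) => x; rewrite /p; case: asboolP => //.
    by case: sD.
  + by rewrite -[leLHS]kK.
  + move=> b Db ab; rewrite -(kK b); apply: fP; first exact: kD.
    by move=> p; apply: k_le.
- move=> FF FS ne tot; split; first by apply: subalg_chain => // D /FS[].
  move=> x [D FD Dx]; have [_ kD] := FS _ FD.
  by apply: depends_on_sub (kD _ Dx) => y Dy; exists D.
- move=> D [sD kD] DT.
  have [x Dx] : exists x, ~ D x.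
    by apply/existsNP => Dall; apply: DT; apply/seteqP; split.
  (* [Phi y] is a finite support of [k y]; closing [x] under [Phi] gives countably many elements
     whose images involve only generators among them. *)
  have /choice[Phi PhiP] y := bool_poly_finite_support (proj2_sig (k y)).
  have [//|//|z [_ [n zn] zP]] := @countable_closure A setT Phi x.
  exists z; split; last by exists n; rewrite zn.
  split; first exact: subalg_gen.
  move=> y; elim=> {y} [y [Dy|[m _ <-]]||a b _ IHa _ IHb|a _ IHa].
  + by apply: depends_on_sub (kD _ Dy) => u Du; apply: gen_base; left.
  + apply: depends_on_sub (PhiP (z m)) => u /= /zP[m' <-].
    by apply: gen_base; right; exists m'.
  + by rewrite k0.
  + by rewrite kI => p q pq; exact: (f_equal2 Order.meet (IHa p q pq) (IHb p q pq)).
  + by rewrite kC => p q pq; exact: (f_equal Order.compl (IHa p q pq)).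
Qed.

End ProjectiveFiltration.

(** Evaluation at [id] maps the free algebra onto [A], each generator going to itself; projectivity
    lifts the identity of [A] to a section. *)
Lemma projective_filtration d (A : ctbDistrLatticeType d) :
  nontrivial_ba A -> projective_ba A -> exists SS : set (set A), filtration SS.
Proof.
move=> ntA pA.
have [|||k hk kK] := pA _ _ A (free_ba A) ntA _ _ id (ba_hom_eval id).
- by move=> /(congr1 (fun u : free_ba A => sval u id)).
- by move=> a; exists (free_var a).
- by split.
exists (stable_subalg k); exact: stable_subalg_filtration.
Qed.

(** * From coherent finite-separation maps to filtrations *)

Section Joins.
Context {d : Order.disp_t} {A : ctbDistrLatticeType d}.
Implicit Types (W : set A).

Definition joins W (a : A) : Prop :=
  exists r : seq A, (forall x, x \in r -> W x) /\ a = \join_(x <- r) x.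

Lemma joins_sub W W' a : (W `<=` W')%classic -> joins W a -> joins W' a.
Proof. by move=> WW' [r [rW ->]]; exists r; split=> // x /rW /WW'. Qed.

Lemma joins_bot W : joins W \bot.
Proof. by exists [::]; rewrite big_nil. Qed.

Lemma joins_mem W x : W x -> joins W x.
Proof.
by move=> Wx; exists [:: x]; rewrite big_seq1; split=> // y; rewrite inE => /eqP->.
Qed.

Lemma joinsU W a b : joins W a -> joins W b -> joins W (a `|` b).
Proof.
move=> [r [rW ->]] [q [qW ->]]; exists (r ++ q); rewrite big_cat; split=> // x.
by rewrite mem_cat => /orP[/rW|/qW].
Qed.

Lemma joins_big W (r : seq A) (f : A -> A) :
  (forall x, x \in r -> joins W (f x)) -> joins W (\join_(x <- r) f x).
Proof.
move=> rW; rewrite big_seq; apply: big_ind => //; first exact: joins_bot.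
by move=> a b; apply: joinsU.
Qed.

Lemma joinsI W a b : (forall x y, W x -> W y -> x `&` y <> \bot -> W (x `&` y)) ->
  joins W a -> joins W b -> joins W (a `&` b).
Proof.
move=> WI [r [rW ->]] [q [qW ->]]; rewrite joins_meetl.
apply: joins_big => x /rW Wx; rewrite meetC joins_meetl.
apply: joins_big => y /qW Wy; have [->|/eqP xy] := eqVneq (y `&` x) \bot.
  exact: joins_bot.
exact/joins_mem/WI.
Qed.

End Joins.

Section CoherentFiltration.
Context {d : Order.disp_t} {A : ctbDistrLatticeType d}.
Variables (X : set A) (s : A -> {fset A}).
Hypotheses (baseX : base X) (closedX : closed_nonzero_meet X)
  (sX : coherent_finite_separation X s) (XT : X \top) (sT : s \top = fset0).
Implicit Types (D Z : set A).

Definition s_closed Z : Prop :=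
  forall x, Z x -> X x /\ forall y, y \in s x -> Z y.

Inductive nonzero_meets Z : set A :=
| nonzero_meets_base x : Z x -> nonzero_meets Z x
| nonzero_meets_meet x y : nonzero_meets Z x -> nonzero_meets Z y ->
    x `&` y <> \bot -> nonzero_meets Z (x `&` y).

Lemma nonzero_meets_big Z (r : seq A) x : nonzero_meets Z x ->
  (forall y, y \in r -> nonzero_meets Z y) -> x `&` \meet_(y <- r) y <> \bot ->
  nonzero_meets Z (x `&` \meet_(y <- r) y).
Proof.
elim: r x => [|y r IH] x Zx rZ; first by rewrite big_nil meetx1.
rewrite big_cons meetA => xy0; apply: IH => //.
  apply: nonzero_meets_meet => //; first by apply: rZ; rewrite inE eqxx.
  by move=> e; apply: xy0; rewrite e meet0x.
by move=> u ur; apply: rZ; rewrite inE ur orbT.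
Qed.

(** By coherence, the values at a meet are nonzero meets of values at the two factors, and these are
    already in the closure. *)
Lemma s_closed_nonzero_meets Z : s_closed Z -> s_closed (nonzero_meets Z).
Proof.
move=> sZ x; elim=> {x} [x /sZ[Xx sx]|x y _ [Xx sx] _ [Xy sy] xy].
  by split=> // y /sx; apply: nonzero_meets_base.
split; first exact: closedX.
move=> u; have xy0 : \bot < x `&` y by rewrite lt0x; apply/eqP.
move=> /(sX.2 _ _ Xx Xy xy0 u)[u0 [G [G0 /fsubsetP GF uE]]].
have GZ v : v \in G -> nonzero_meets Z v.
  by move=> /GF /fsetUP[/sx|/sy].
(* [nonzero_meets_big] needs a first factor: a member [v] of the nonempty [G] is repeated, as [u]
   equals [v]&[u]. *)
have [G0'|[v vG]] := fset_0Vmem G; first by rewrite G0' in G0.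
have uv : u <= v by rewrite uE; apply: (meets_inf_seq id).
rewrite -(meet_r uv) [X in v `&` X]uE; apply: nonzero_meets_big => //; first exact: GZ.
by rewrite -uE (meet_r uv).
Qed.

(* [s] may take values outside [D] on the elements of [X] lying in [D]; [core D]
   collects those from which iterating [s] never leaves [D]. *)
Definition core D : set A := [set x | exists Z, [/\ Z `<=` D, s_closed Z & Z x]]%classic.

Lemma core_sub D : (core D `<=` D)%classic.
Proof. by move=> x [Z [ZD _ /ZD]]. Qed.

Lemma core_mono D D' : (D `<=` D')%classic -> (core D `<=` core D')%classic.
Proof. by move=> DD' x [Z [ZD sZ Zx]]; exists Z; split=> // y /ZD /DD'. Qed.

Lemma s_closed_core D : s_closed (core D).
Proof.
move=> x [Z [ZD sZ Zx]]; have [Xx sx] := sZ _ Zx; split=> // y /sx Zy.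
by exists Z.
Qed.

Lemma core_meet D x y : subalg D -> core D x -> core D y -> x `&` y <> \bot ->
  core D (x `&` y).
Proof.
move=> [_ DI _] Dx Dy xy; exists (nonzero_meets (core D)); split.
- by move=> u; elim=> {u} [u /core_sub|u v _ Du _ Dv _] //; apply: DI.
- exact/s_closed_nonzero_meets/s_closed_core.
- by apply: nonzero_meets_meet => //; apply: nonzero_meets_base.
Qed.

Definition core_generated D : Prop :=
  subalg D /\ forall a, D a -> joins (core D) a.

Lemma base_join a : exists F : {fset A}, (forall x, x \in F -> X x) /\ a = \join_(x <- F) x.
Proof.
have [->|/eqP a0] := eqVneq a \bot; first by exists fset0; rewrite big_seq_fset0.
by have [F [FX _ aE]] := baseX.2 _ a0; exists F.
Qed.

Lemma rc_join D a b : subalg D ->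
  (exists u, [/\ D u, a <= u & forall c, D c -> a <= c -> u <= c]) ->
  (exists u, [/\ D u, b <= u & forall c, D c -> b <= c -> u <= c]) ->
  exists u, [/\ D u, a `|` b <= u & forall c, D c -> a `|` b <= c -> u <= c].
Proof.
move=> sD [u [Du au uP]] [v [Dv bv vP]]; exists (u `|` v); split.
- exact: subalgU.
- exact: leU2.
- by move=> c Dc; rewrite !leUx => /andP[ac bc]; rewrite uP ?vP.
Qed.

(** For [a] in [X], the least upper approximation is the complement of the join of those members of
    the finite set [s a] that lie in [D] and miss [a]. Joins then give the general case. *)
Lemma core_generated_rc D : core_generated D -> relatively_complete D.
Proof.
move=> [sD cD] a; have [D0 DI DC] := sD.
have [F [FX ->]] := base_join a; rewrite big_seq.
apply: (big_ind (fun a => exists u,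
  [/\ D u, a <= u & forall c, D c -> a <= c -> u <= c])).
- by exists \bot; split=> // c _ _; apply: le0x.
- by move=> x y; apply: rc_join.
move=> {}a /FX Xa.
pose e := \join_(y <- s a | `[< D y /\ y `&` a = \bot >]) y.
have De : D e.
  by apply: big_ind => // [x y|y /asboolP[]//]; apply: subalgU.
exists (~` e); split; first exact: DC.
  rewrite lexC; apply/joinsP_seq => y _ /asboolP[_ ya].
  exact/disjP.
move=> b Db ab; rewrite leCx.
have [r [rZ bE]] := cD _ (DC _ Db); rewrite bE; apply/joinsP_seq => x xr _.
have [Z [ZD sZ Zx]] := rZ _ xr; have [Xx sx] := sZ _ Zx.
have ax : a `&` x = \bot.
  apply/disjP; apply: le_trans ab _; rewrite lexC bE.
  exact: (joins_sup_seq id).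
(* The separating element [f] above [x] belongs to [s a], and also to [s x], hence to [D] because
   [x] lies in an [s]-closed subset of [D]. So [f] is one of the terms of [e]. *)
have [c [f [/fsetIP[_ _] /fsetIP[fa fx] cf ac xf]]] := sX.1.2 _ _ Xa Xx ax.
apply: le_trans xf _; apply: (joins_sup_seq id) => //.
apply/asboolP; split; first exact/ZD/sx.
by rewrite meetC; apply: disjoint_le ac (lexx f) cf.
Qed.

Lemma core_generated_filtration : filtration core_generated.
Proof.
have coreT D : D \top -> core D \top.
  move=> DT; exists [set \top]%classic; split=> // [_ ->//|_ ->].
  by split=> // y; rewrite sT.
split.
- split; first exact: subalg_bot.
  move=> a [] ->; first exact: joins_bot.
  by apply/joins_mem/coreT; right.
- by move=> D [].
- exact: core_generated_rc.
- move=> FF FS ne tot; split; first by apply: subalg_chain => // D /FS[].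
  move=> a [D FD Da]; have [_ /(_ _ Da)] := FS _ FD.
  by apply/joins_sub/core_mono => x Dx; exists D.
- move=> D [sD cD] DT.
  have [x Xx Dx] : exists2 x, X x & ~ D x.
    apply: contrapT => n; apply: DT; apply/seteqP; split=> // a _.
    have [F [FX ->]] := base_join a; apply: subalg_joins => // x /FX Xx.
    by apply: contrapT => Dx; apply: n; exists x.
  (* Closing under [F] as well as [s] makes the complement of each new generator a join of new
     generators. *)
  have /choice[F FP] y := base_join (~` y).
  have [||z [Xz [n zn] zP]] := @countable_closure A X (fun y => s y `|` F y)%fset x.
  + by [].
  + move=> y u Xy /fsetUP[|]; last by have [h _] := FP y; apply: h.
    exact: sX.1.1.
  pose E := gen (D `|` range z)%classic.
  exists z; split; last by exists n; rewrite zn.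
  have sE : subalg E by apply: subalg_gen.
  split=> //.
  have cDE : (core D `<=` core E)%classic by apply: core_mono => y Dy; apply: gen_base; left.
  (* The range of [z] is itself an [s]-closed set, which places it in the core. *)
  have cz m : core E (z m).
    exists (range z)%classic; split; [|move=> _ [i _ <-]; split=> // y ys|by exists m].
      by move=> y zy; apply: gen_base; right.
    by have [|j <-] := zP i y; [apply/fsetUP; left|exists j].
  (* The complement is included in the claim so that the induction passes through complements. *)
  suff main a : E a -> joins (core E) a /\ joins (core E) (~` a) by move=> a /main[].
  have [D0 DI DC] := sD.
  elim=> {a} [a [Da|[m _ <-]]||a b _ [ja jca] _ [jb jcb]|a _ [ja jca]].
  + by split; apply: joins_sub cDE _; apply: cD => //; apply: DC.
  + split; first exact/joins_mem/cz.
    have [_ zE] := FP (z m); exists (F (z m)); split=> // y yF.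
    by have [|j <-] := zP m y; [apply/fsetUP; right|apply: cz].
  + split; first exact: joins_bot.
    by rewrite compl0; apply/joins_mem/coreT/(subalgT sE).
  + split; last by rewrite complI; apply: joinsU.
    by apply: joinsI => // x' y' cx cy; apply: core_meet.
  + by rewrite complK.
Qed.

End CoherentFiltration.

(** With an empty value at [\top], the singleton of [\top] is [s]-closed, so [\top] lies in the core
    of every subalgebra. Separation is unaffected, since no nonzero element is disjoint from
    [\top]. *)
Lemma separation_with_top d (A : ctbDistrLatticeType d) (X : set A) s :
  nontrivial_ba A -> base X -> closed_nonzero_meet X ->
  coherent_finite_separation X s ->
  let X' := [set x | X x \/ x = \top]%classic in
  let s' := fun x => if x == \top then fset0 else s x in
  [/\ base X', closed_nonzero_meet X' & coherent_finite_separation X' s'].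
Proof.
move=> ntA [X0 baseX] closedX [[sX sep] coh] X' s'.
have s'E x : x <> \top -> s' x = s x by move=> /eqP/negbTE xT; rewrite /s' xT.
have s'T : s' \top = fset0 by rewrite /s' eqxx.
have nz x : X' x -> x <> \bot by case=> [/X0|-> /esym].
split; [split=> //| |split; [split|]].
- move=> a /baseX[F [FX Fd aE]]; exists F; split=> // x /FX; by left.
- move=> a b [Xa|->] [Xb|->] ab; rewrite ?meet1x ?meetx1.
  + by left; apply: closedX.
  + by left.
  + by left.
  + by right.
- move=> a [Xa|->] x; last by rewrite s'T.
  have [->|/eqP aT] := eqVneq a \top; first by rewrite s'T.
  by rewrite s'E // => /(sX _ Xa); left.
- move=> a b Xa Xb ab.
  have aT : a <> \top by move=> e; apply: (nz _ Xb); rewrite -ab e meet1x.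
  have bT : b <> \top by move=> e; apply: (nz _ Xa); rewrite -ab e meetx1.
  rewrite !s'E //; case: Xa Xb => // Xa [Xb|//]; exact: sep.
- move=> a b Xa Xb ab x.
  have [->|/eqP abT] := eqVneq (a `&` b) \top; first by rewrite s'T.
  rewrite s'E //.
  have mem c : X' c -> c <> \top -> x \in s c -> x \in s' c /\ x <> \bot.
    by move=> [Xc|//] cT xc; rewrite s'E //; split=> //; apply/X0/(sX _ Xc).
  (* If one factor is [\top], the meet is the other factor, whose own values appear in the union. *)
  have [aT|/eqP aT] := eqVneq a \top.
    move: abT; rewrite aT meet1x => bT /(mem _ Xb bT)[xb x0].
    by apply: mem_meet_closure => //; apply/fsetUP; right.
  have [bT|/eqP bT] := eqVneq b \top.
    rewrite bT meetx1 => /(mem _ Xa aT)[xa x0].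
    by apply: mem_meet_closure => //; apply/fsetUP; left.
  by rewrite !s'E //; case: Xa Xb => // Xa [Xb|//]; apply: coh.
Qed.

Lemma separation_filtration d (A : ctbDistrLatticeType d) (X : set A) s :
  nontrivial_ba A -> base X -> closed_nonzero_meet X ->
  coherent_finite_separation X s -> exists SS : set (set A), filtration SS.
Proof.
move=> ntA bX cX sX; have [bX' cX' sX'] := separation_with_top ntA bX cX sX.
eexists; apply: (core_generated_filtration bX' cX' sX'); first by right.
by rewrite eqxx.
Qed.

Theorem theoremA (d : Order.disp_t) (A : ctbDistrLatticeType d)
    (A_nontrivial : nontrivial_ba A) :
  projective_ba A <->
  exists X : set A,
    [/\ base X, closed_nonzero_meet X
      & exists s : A -> {fset A}, coherent_finite_separation X s].
Proof.
split=> [/(projective_filtration A_nontrivial)[SS fS]|[X [bX cX [s sX]]]].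
  exact: filtration_separation fS.
have [SS fS] := separation_filtration A_nontrivial bX cX sX.
exact: filtration_projective fS.
Qed.
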